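(* If $A$ is an S4 De Morgan algebra, then its prime spectrum $\mathcal{S}_0(A)$ is an S4 De Morgan spectral space.
   Context: A De Morgan algebra is a bounded distributive lattice $\langle A;\wedge,\vee,0,1\rangle$ with a unary operation $-$ such that $a\leq b$ implies $-b\leq -a$, and $--a=a$. An S4 De Morgan algebra is a De Morgan algebra with a unary operation $\nabla$ such that $\nabla(a\vee b)=\nabla a\vee\nabla b$, $\nabla 0=0$, $a\leq\nabla a$, and $\nabla\nabla a\leq\nabla a$. The prime spectrum of $A$ is $\mathcal{S}_0(A)=\langle\mathfrak{P}(A);g_A,R_A,\tau(\beta)\rangle$, where $\mathfrak{P}(A)$ is the set of prime (in particular proper) filters of $A$; $g_A(x)=\{a\in A:-a\notin x\}$; $xR_Ay$ iff for all $a\in A$, $a\in x$ implies $\nabla a\in y$; and $\tau(\beta)$ is the topology with basis $\{\phi(a):a\in A\}$, $\phi(a)=\{x\in\mathfrak{P}(A):a\in x\}$. For a topological space $X$, $\Omega(X)$ is the set of compact open subsets of $X$, and the specialization order is: $x\leqslant y$ iff every open set containing $x$ contains $y$. A spectral space is a compact, $T_0$, sober space $X$ such that $\Omega(X)$ is closed under finite intersections and is a basis for $X$ (sober: every completely prime filter of the lattice of open sets is the set of open neighbourhoods of some point). Given $g\colon X\to X$ and $R\subseteq X\times X$, for $U\subseteq X$ put $U^*=\{x\in X: g(x)\notin U\}$ and $\nabla_R U=R[U]=\{y\in X:\exists x\in U,\ xRy\}$. An S4 De Morgan spectral space is $\langle X;g,R,\tau\rangle$ such that: (1) $\langle X;\tau\rangle$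 is a spectral space; (2) $g\colon X\to X$ is an order-inverting involution with respect to $\leqslant$, and $R$ is reflexive and transitive; (3) if $U\in\Omega(X)$ then $U^*,\nabla_RU\in\Omega(X)$; (4) if not $xRy$, there is $U\in\Omega(X)$ with $x\in U$ and $y\notin\nabla_RU$. *)

(* Defs.v *)
From HB Require Import structures.
From mathcomp Require Import all_boot all_order.
From mathcomp Require Import all_classical.
From mathcomp Require Import topology.

Set Implicit Arguments.
Unset Strict Implicit.
Unset Printing Implicit Defensive.

Import Order.TTheory.
Local Open Scope classical_set_scope.

(* Trivial algebras (\bot = \top) are allowed, as in tbDistrLatticeType. *)
HB.mixin Record isDeMorgan (d : Order.disp_t) T
    & Order.TBDistrLattice d T := {
  dmneg : T -> T;
  dmneg_anti : forall a b : T, (a <= b)%O -> (dmneg b <= dmneg a)%O;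
  dmnegK : forall a : T, dmneg (dmneg a) = a
}.

#[short(type="deMorganType")]
HB.structure Definition DeMorgan (d : Order.disp_t) :=
  {T of Order.TBDistrLattice d T & isDeMorgan d T}.

HB.mixin Record hasS4Nabla (d : Order.disp_t) T & DeMorgan d T := {
  nabla : T -> T;
  nablaU : forall a b : T,
    nabla (Order.join a b) = Order.join (nabla a) (nabla b);
  nabla0 : nabla \bot%O = \bot%O;
  le_nabla : forall a : T, (a <= nabla a)%O;
  nabla_nabla_le : forall a : T, (nabla (nabla a) <= nabla a)%O
}.

#[short(type="s4DeMorganType")]
HB.structure Definition S4DeMorgan (d : Order.disp_t) :=
  {T of DeMorgan d T & hasS4Nabla d T}.

Record lattice_filter (d : Order.disp_t) (L : latticeType d) (x : set L) :
    Prop := {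
  filter_neq0 : x !=set0;
  filter_up : forall a b : L, (a <= b)%O -> x a -> x b;
  filter_meet : forall a b : L, x a -> x b -> x (Order.meet a b)
}.

Record prime_filter (d : Order.disp_t) (L : latticeType d) (x : set L) :
    Prop := {
  prime_filter_filter : lattice_filter x;
  prime_filter_proper : x <> setT;
  prime_filter_join : forall a b : L, x (Order.join a b) -> x a \/ x b
}.

Record prime_spectrum (d : Order.disp_t) (L : latticeType d) := PrimeFilter {
  pfilter :> L -> Prop;
  pfilterP : prime_filter (pfilter : set L)
}.

HB.instance Definition _ (d : Order.disp_t) (L : latticeType d) :=
  gen_eqMixin (prime_spectrum L).
HB.instance Definition _ (d : Order.disp_t) (L : latticeType d) :=
  gen_choiceMixin (prime_spectrum L).

Definition spec_phi (d : Order.disp_t) (L : latticeType d) (a : L) :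
    set (prime_spectrum L) :=
  [set x | x a].

Section SpectrumTopology.
Context (d : Order.disp_t) (L : latticeType d).

Let phi_cover :
  \bigcup_(U in range (@spec_phi d L)) U = [set: prime_spectrum L].
Proof.
apply/seteqP; split=> // x _.
have [[a xa] _ _] := prime_filter_filter (pfilterP x).
by exists (spec_phi a) => //; exists a.
Qed.

Let phi_join (U V : set (prime_spectrum L)) (x : prime_spectrum L) :
  range (@spec_phi d L) U -> range (@spec_phi d L) V -> U x -> V x ->
  exists W, [/\ range (@spec_phi d L) W, W x & W `<=` U `&` V].
Proof.
move=> [a _ <-] [b _ <-] xa xb; exists (spec_phi (Order.meet a b)).
split; first by exists (Order.meet a b).
  exact: (filter_meet (prime_filter_filter (pfilterP x))).
have up (y : prime_spectrum L) := filter_up (prime_filter_filter (pfilterP y)).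
by move=> y yab; split; apply: up yab; [exact: leIl | exact: leIr].
Qed.

HB.instance Definition _ := @isBaseTopological.Build (prime_spectrum L)
  (set (prime_spectrum L)) (range (@spec_phi d L)) id phi_cover phi_join.

End SpectrumTopology.

Lemma dmnegI (d : Order.disp_t) (A : deMorganType d) (a b : A) :
  dmneg (Order.meet a b) = Order.join (dmneg a) (dmneg b).
Proof.
apply/le_anti/andP; split; last first.
  by rewrite leUx; apply/andP; split; apply: dmneg_anti; rewrite ?leIl ?leIr.
rewrite -[leRHS]dmnegK; apply: dmneg_anti.
rewrite lexI; apply/andP; split.
  by rewrite -[leRHS]dmnegK; apply: dmneg_anti; rewrite leUl.
by rewrite -[leRHS]dmnegK; apply: dmneg_anti; rewrite leUr.
Qed.

Lemma dmnegU (d : Order.disp_t) (A : deMorganType d) (a b : A) :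
  dmneg (Order.join a b) = Order.meet (dmneg a) (dmneg b).
Proof. by apply: (can_inj dmnegK); rewrite dmnegI !dmnegK. Qed.

Lemma prime_filter_dmneg (d : Order.disp_t) (A : deMorganType d) (x : set A) :
  prime_filter x -> prime_filter [set a : A | ~ x (dmneg a)].
Proof.
move=> [[[c xc] xup xI] xT xU]; have x1 : x \top%O by apply: xup xc; exact: lex1.
have x0 : ~ x \bot%O.
  move=> x0; apply: xT; apply/seteqP; split=> // a _; apply: xup x0.
  exact: le0x.
split; [split | |].
- exists \top%O => /= x1'; apply: x0; apply: xup x1'.
  by rewrite -[leRHS]dmnegK dmneg_anti ?lex1.
- by move=> a b ab /= xa xb; apply: xa; apply: xup xb; apply: dmneg_anti.
- by move=> a b /= xa xb; rewrite dmnegI => /xU[].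
- move=> gT; have : [set: A] \bot%O by []; rewrite -gT /=; apply.
  by apply: xup x1; rewrite -[leLHS]dmnegK dmneg_anti ?le0x.
- move=> a b /=; rewrite dmnegU => xab.
  have [xa|] := pselect (x (dmneg a)); last by left.
  by right=> xb; apply: xab; apply: xI.
Qed.

Definition spec_g (d : Order.disp_t) (A : deMorganType d)
    (x : prime_spectrum A) : prime_spectrum A :=
  PrimeFilter (prime_filter_dmneg (pfilterP x)).

Definition spec_R (d : Order.disp_t) (A : s4DeMorganType d)
    (x y : prime_spectrum A) : Prop :=
  forall a : A, x a -> y (nabla a).

Definition compact_opens (X : topologicalType) : set (set X) :=
  [set U | compact U /\ open U].

Definition specialization (X : topologicalType) (x y : X) : Prop :=
  forall U : set X, open U -> U x -> U y.

(* Taking S empty in [cpf_bigU] shows that such an F does not contain set0. *)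
Record completely_prime_filter (X : topologicalType) (F : set (set X)) :
    Prop := {
  cpf_open : F `<=` open;
  cpf_neq0 : F !=set0;
  cpf_up : forall U V : set X, open V -> U `<=` V -> F U -> F V;
  cpf_meet : forall U V : set X, F U -> F V -> F (U `&` V);
  cpf_bigU : forall S : set (set X), S `<=` open ->
    F (\bigcup_(U in S) U) -> exists2 U, S U & F U
}.

Definition sober (X : topologicalType) : Prop :=
  forall F : set (set X), completely_prime_filter F ->
    exists x : X, F = open_nbhs x.

Record spectral_space (X : topologicalType) : Prop := {
  spectral_compact : compact [set: X];
  spectral_T0 : kolmogorov_space X;
  spectral_sober : sober X;
  spectral_setI : forall U V : set X,
    compact_opens U -> compact_opens V -> compact_opens (U `&` V);
  spectral_basis : basis (@compact_opens X)
}.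

Definition dm_star (X : Type) (g : X -> X) (U : set X) : set X :=
  [set x | ~ U (g x)].

Definition nabla_rel (X : Type) (R : X -> X -> Prop) (U : set X) : set X :=
  [set y | exists2 x, U x & R x y].

Record s4_de_morgan_spectral_space (X : topologicalType)
    (g : X -> X) (R : X -> X -> Prop) : Prop := {
  s4dm_spectral : spectral_space X;
  s4dm_g_invol : involutive g;
  s4dm_g_anti : forall x y : X,
    specialization x y -> specialization (g y) (g x);
  s4dm_R_refl : forall x : X, R x x;
  s4dm_R_trans : forall x y z : X, R x y -> R y z -> R x z;
  s4dm_star : forall U : set X,
    compact_opens U -> compact_opens (dm_star g U);
  s4dm_nabla : forall U : set X,
    compact_opens U -> compact_opens (nabla_rel R U);
  s4dm_sep : forall x y : X, ~ R x y ->
    exists U : set X, [/\ compact_opens U, U x & ~ nabla_rel R U y]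
}.
Arguments s4_de_morgan_spectral_space : clear implicits.

(* Main.v *)
(* By the prime filter theorem (separation of a filter from an ideal in a
   distributive lattice), the compact open subsets of the spectrum are exactly
   the sets [spec_phi a]; the operations on compact opens are then computed on
   elements of the algebra, as [spec_phi (dmneg a)] and [spec_phi (nabla a)]. *)
Require Import Defs.
From mathcomp Require Import all_boot all_order.
From mathcomp Require Import all_classical.
From mathcomp Require Import topology.

Set Implicit Arguments.
Unset Strict Implicit.
Unset Printing Implicit Defensive.

Import Order.TTheory.
Local Open Scope classical_set_scope.

(** * Separating a filter from an ideal by a prime filter *)

Record lattice_ideal (d : Order.disp_t) (L : latticeType d) (I : set L) :
    Prop := {
  ideal_neq0 : I !=set0;
  ideal_down : forall a b : L, (a <= b)%O -> I b -> I a;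
  ideal_join : forall a b : L, I a -> I b -> I (Order.join a b)
}.

Section PrimeFilterTheorem.
Context (d : Order.disp_t) (L : distrLatticeType d).

(** This is the filter generated by [G] and [a]; comparing it with a maximal [G] yields
    primeness. *)
Lemma lattice_filter_adjoin (G : set L) (a : L) :
  lattice_filter G ->
  lattice_filter [set c | exists2 g, G g & (Order.meet g a <= c)%O].
Proof.
move=> [[g0 Gg0] Gup GI]; split.
- by exists g0, g0 => //; exact: leIl.
- by move=> b c bc [g Gg gb]; exists g => //; exact: le_trans gb bc.
- move=> b c [g Gg gb] [h Gh hc]; exists (Order.meet g h); first exact: GI.
  by rewrite -[a in leLHS]meetxx meetACA; exact: leI2.
Qed.

(** Zorn's lemma: the union of a nonempty chain of filters containing [F] and disjoint from [I] is
    again such a filter. *)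
Lemma maximal_disjoint_filter (F I : set L) :
  lattice_filter F -> (forall a, F a -> ~ I a) ->
  exists G : set L, [/\ lattice_filter G, F `<=` G, forall a, G a -> ~ I a &
    forall H : set L, lattice_filter H -> G `<=` H -> (forall a, H a -> ~ I a) ->
      H `<=` G].
Proof.
move=> Ffil FI.
(* The union of the empty chain is [set0], hence the union with [F]. *)
pose P := [set X : set L |
  lattice_filter (F `|` X) /\ forall a, (F `|` X) a -> ~ I a].
have [|M [[Mfil MI] Mmax]] := @Zorn_bigcup _ P.
  move=> C CP Ctot; split.
    split.
    - by have [[a Fa] _ _] := Ffil; exists a; left.
    - move=> a b ab [Fa|[X CX Xa]]; first by left; exact: (filter_up Ffil) Fa.
      have [Fb|Xb] := filter_up (CP X CX).1 ab (or_intror Xa).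
        by left.
      by right; exists X.
    - have case1 X a b : C X -> (F `|` X) a -> (F `|` X) b ->
          (F `|` \bigcup_(Y in C) Y) (Order.meet a b).
        move=> CX Xa Xb.
        have [|Xab] := filter_meet (CP X CX).1 Xa Xb; first by left.
        by right; exists X.
      move=> a b [Fa|[X CX Xa]] [Fb|[Y CY Yb]].
      + by left; exact: (filter_meet Ffil).
      + by apply: (case1 Y) => //; [left|right].
      + by apply: (case1 X) => //; [right|left].
      + have [XY|YX] := Ctot X Y CX CY.
          by apply: (case1 Y) => //; right => //; exact: XY.
        by apply: (case1 X) => //; right => //; exact: YX.
  by move=> a [Fa|[X CX Xa]]; [exact: FI | apply: (CP X CX).2; right].
exists (F `|` M); split=> //.
move=> H Hfil GH HI.
(* Since [H] absorbs [F], it satisfies [P] itself, so the maximality of [M] applies to it. *)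
have FH : F `|` H = H by apply/setUidPr => a Fa; apply: GH; left.
have MH : M `<=` H by move=> a Ma; apply: GH; right.
move=> a Ha; apply: contrapT => nGa; apply: (Mmax H); last by split; rewrite FH.
by split=> // HM; apply: nGa; right; exact: HM.
Qed.

(** A maximal [G] disjoint from [I] is prime. If it contains neither [a] nor [b], adjoining either
    one meets [I], which gives [g] and [h] in [G] whose meets with [a] and [b] lie in [I]. By
    distributivity the meet of [g], [h] and the join of [a] and [b] is then in both [G] and [I]. *)
Lemma prime_filter_theorem (F I : set L) :
  lattice_filter F -> lattice_ideal I -> (forall a, F a -> ~ I a) ->
  exists x : prime_spectrum L, (forall a, F a -> x a) /\ forall a, I a -> ~ x a.
Proof.
move=> Ffil [[i0 Ii0] Idown IU] FI.
have [G [Gfil FG GI Gmax]] := maximal_disjoint_filter Ffil FI.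
have meetI a : ~ G a -> exists2 g, G g & I (Order.meet g a).
  move=> nGa; apply: contrapT => nI; apply: nGa.
  apply: (Gmax _ (lattice_filter_adjoin a Gfil)).
  - by move=> g Gg; exists g => //; exact: leIl.
  - by move=> c [g Gg gc] Ic; apply: nI; exists g => //; exact: Idown Ic.
  - by have [g Gg] := filter_neq0 Gfil; exists g => //; exact: leIr.
have Gprime : prime_filter G.
  split=> //; first by move=> GT; apply: (GI i0) => //; rewrite GT.
  move=> a b Gab; apply: contrapT => /not_orP[/meetI[g Gg ga] /meetI[h Gh hb]].
  have /GI : G (Order.meet (Order.meet g h) (Order.join a b)).
    by do 2?apply: (filter_meet Gfil).
  apply; rewrite meetUr; apply: IU.
    by apply: Idown ga; rewrite leI2 ?leIl.
  by apply: Idown hb; rewrite leI2 ?leIr.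
exists (PrimeFilter Gprime); split; first exact: FG.
by move=> a Ia /GI.
Qed.

End PrimeFilterTheorem.

(** * Basic open sets and the T0 axiom *)

Section SpectrumPoints.
Context (d : Order.disp_t) (L : latticeType d).
Implicit Types (x y : prime_spectrum L) (a b : L).

Lemma spec_up x a b : (a <= b)%O -> x a -> x b.
Proof. exact: (filter_up (prime_filter_filter (pfilterP x))). Qed.

Lemma spec_phiI a b : spec_phi (Order.meet a b) = spec_phi a `&` spec_phi b.
Proof.
apply/seteqP; split=> x /=.
  by move=> xab; split; apply: spec_up xab; [exact: leIl | exact: leIr].
by move=> [xa xb]; exact: (filter_meet (prime_filter_filter (pfilterP x))).
Qed.

Lemma spec_phiU a b : spec_phi (Order.join a b) = spec_phi a `|` spec_phi b.
Proof.
apply/seteqP; split=> x /=; first exact: (prime_filter_join (pfilterP x)).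
by case; apply: spec_up; [exact: leUl | exact: leUr].
Qed.

Lemma spec_phi_le a b : (a <= b)%O -> spec_phi a `<=` spec_phi b.
Proof. by move=> ab x; exact: spec_up. Qed.

Lemma prime_spectrum_ext x y : (forall a, x a <-> y a) -> x = y.
Proof.
case: x y => [x xP] [y yP] /= xy.
have {}xy : x = y by apply/funext => a; apply/propext.
by rewrite xy in xP *; congr PrimeFilter; exact: Prop_irrelevance.
Qed.

Lemma open_spec_phi a : open (@spec_phi d L a).
Proof.
by exists [set spec_phi a]; [move=> _ ->; exists a | exact: bigcup_set1].
Qed.

Lemma open_spec_phi_sub (U : set (prime_spectrum L)) x : open U -> U x ->
  exists2 a, x a & spec_phi a `<=` U.
Proof.
move=> [D DB <-] [V DV Vx]; have [a _ aV] := DB V DV.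
by exists a; [rewrite -aV in Vx | rewrite aV; exact: bigcup_sup DV].
Qed.

(** This is the form of union to which complete primeness, [cpf_bigU], applies. *)
Lemma open_bigcup_spec_phi (U : set (prime_spectrum L)) : open U ->
  U = \bigcup_(V in [set V | range (@spec_phi d L) V /\ V `<=` U]) V.
Proof.
move=> Uop; apply/seteqP; split=> [x Ux | x [V [_ VU] /VU]//].
have [a xa aU] := open_spec_phi_sub Uop Ux.
by exists (spec_phi a) => //; split=> //; exists a.
Qed.

Lemma kolmogorov_prime_spectrum : kolmogorov_space (prime_spectrum L).
Proof.
have half x y a : x a -> ~ y a ->
    spec_phi a \in nbhs x /\ y \in ~` spec_phi a.
  move=> xa ya; rewrite !inE; split=> //.
  by apply: open_nbhs_nbhs; split=> //; exact: open_spec_phi.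
move=> x y /eqP xy; have /existsNP[a] : ~ forall a, x a <-> y a.
  by move=> /prime_spectrum_ext.
have [xa|xa] := pselect (x a); have [ya|ya] := pselect (y a) => nxy.
- by case: nxy.
- by exists (spec_phi a); left; exact: half.
- by exists (spec_phi a); right; exact: half.
- by case: nxy.
Qed.

End SpectrumPoints.

(** * Compactness, compact opens and sobriety *)

Section Spectrum.
Context (d : Order.disp_t) (L : tbDistrLatticeType d).
Implicit Types (x y : prime_spectrum L) (a b : L).

Lemma spec_phi1 : spec_phi \top%O = [set: prime_spectrum L].
Proof.
apply/seteqP; split=> // x _.
have [[a xa] _ _] := prime_filter_filter (pfilterP x).
by apply: spec_up xa; exact: lex1.
Qed.

Lemma spec_phi0 : spec_phi \bot%O = set0 :> set (prime_spectrum L).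
Proof.
apply/seteqP; split=> // x x0; apply: (prime_filter_proper (pfilterP x)).
by apply/seteqP; split=> // a _; apply: spec_up x0; exact: le0x.
Qed.

Lemma prime_spectrum_avoid (I : set L) a : lattice_ideal I -> ~ I a ->
  exists2 x : prime_spectrum L, x a & forall b, I b -> ~ x b.
Proof.
move=> Iid nIa; have := @prime_filter_theorem _ _ [set b | (a <= b)%O] I.
case=> //.
- split; first by exists a => /=.
    by move=> b c bc /= ab; exact: le_trans ab bc.
  by move=> b c /= ab ac; rewrite lexI ab.
- by move=> b /= ab Ib; apply: nIa; exact: (ideal_down Iid) Ib.
- by move=> x [xa xI]; exists x => //; apply: xa => /=.
Qed.

(* For a filter [F] containing [spec_phi a], the [b] with
   [F (~` spec_phi b)] form an ideal not containing [a]; a prime filter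
   containing [a] and avoiding this ideal is a cluster point of [F]. *)
Lemma compact_spec_phi a : compact (@spec_phi d L a).
Proof.
move=> F FF Fa; pose I := [set b | F (~` @spec_phi d L b)].
have [||x xa xI] := @prime_spectrum_avoid I a.
- split.
  + by exists \bot%O; rewrite /I /= spec_phi0 setC0; exact: filterT.
  + by move=> b c bc; apply: filterS; exact/subsetC/spec_phi_le.
  + by move=> b c Fb Fc; rewrite /I /= spec_phiU setCU; exact: filterI.
- move=> Ia; apply: (@filter_not_empty _ F).
  by rewrite -(setICr (spec_phi a)); exact: filterI.
exists x; split=> // U V FU; rewrite nbhsE => -[W [Wop Wx] WV].
have [b xb bW] := open_spec_phi_sub Wop Wx.
(* If [U] misses [V], it misses [spec_phi b], which puts [b] in [I], although [b] belongs to [x]. *)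
apply: contrapT => UV; apply: (xI b) => //; apply: filterS FU.
by move=> y Uy yb; apply: UV; exists y; split=> //; exact/WV/bW.
Qed.

(* If no [spec_phi a] contained in [U] were [U], the sets [U `\` spec_phi a]
   would generate a proper filter on [U] without cluster point in [U]. *)
Lemma compact_opens_spec_phi (U : set (prime_spectrum L)) :
  compact_opens U <-> exists a, U = spec_phi a.
Proof.
split=> [[Ucpt Uop] | [a ->]]; last first.
  by split; [exact: compact_spec_phi | exact: open_spec_phi].
apply: contrapT => nU.
pose J := [set a | @spec_phi d L a `<=` U].
have J0 : J \bot%O by rewrite /J /= spec_phi0; exact: sub0set.
have Ffil : Filter (filter_from J (fun a => U `\` spec_phi a)).
  apply: filter_from_filter; first by exists \bot%O.
  move=> a b Ja Jb; exists (Order.join a b).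
    by rewrite /J /= spec_phiU subUset.
  by rewrite spec_phiU setDUr.
have [||x [Ux clx]] := Ucpt (filter_from J (fun a => U `\` spec_phi a)).
- apply: filter_from_proper => a Ja; apply: contrapT => /nonemptyPn Ua0.
  apply: nU; exists a; apply/seteqP; split=> //; by rewrite -setD_eq0.
- by exists \bot%O => // x [].
(* The cluster point has a basic neighbourhood [spec_phi a] inside [U], and this is disjoint from
   the generator indexed by [a]. *)
have [a xa aU] := open_spec_phi_sub Uop Ux.
have [||y [[_ ya] /ya]//] := clx (U `\` spec_phi a) (spec_phi a).
  by exists a.
by apply: open_nbhs_nbhs; split=> //; exact: open_spec_phi.
Qed.

(** The point is the set of [a] with [spec_phi a] in [F]. Complete primeness makes it proper (empty
    family) and prime (two-element family); applied to the basic sets inside an open set, it shows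
    that [F] is determined by this point. *)
Lemma sober_prime_spectrum : sober (prime_spectrum L).
Proof.
move=> F [Fop [U0 FU0] Fup FI Fbig].
have xP : prime_filter [set a | F (@spec_phi d L a)].
  split; first split.
  - exists \top%O => /=; apply: Fup FU0; first exact: open_spec_phi.
    by rewrite spec_phi1.
  - by move=> a b ab; apply: Fup; [exact: open_spec_phi | exact: spec_phi_le].
  - by move=> a b Fa Fb /=; rewrite spec_phiI; exact: FI.
  - move=> FT; have : [set: L] \bot%O by [].
    rewrite -FT /= spec_phi0 -(bigcup_set0 (fun U : set _ => U)).
    by move=> /Fbig[].
  - move=> a b /= Fab.
    have [| |U [->|->]] := Fbig [set spec_phi a; spec_phi b].
    + by move=> _ [->|->]; exact: open_spec_phi.
    + by rewrite bigcup_setU1 bigcup_set1 -spec_phiU.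
    + by left.
    + by right.
exists (PrimeFilter xP); apply/seteqP; split=> U.
  move=> FU; have Uop := Fop _ FU; split=> //.
  move: (FU); rewrite [in F U](open_bigcup_spec_phi Uop) => /Fbig[|V [[a _ <-] aU] Fa].
    by move=> _ [[a _ <-] _]; exact: open_spec_phi.
  exact: aU.
by move=> [Uop /(open_spec_phi_sub Uop)[a Fa aU]]; exact: Fup Fa.
Qed.

Lemma spectral_prime_spectrum : spectral_space (prime_spectrum L).
Proof.
split.
- by rewrite -spec_phi1; exact: compact_spec_phi.
- exact: kolmogorov_prime_spectrum.
- exact: sober_prime_spectrum.
- move=> U V /compact_opens_spec_phi[a ->] /compact_opens_spec_phi[b ->].
  by apply/compact_opens_spec_phi; exists (Order.meet a b); rewrite spec_phiI.
- split=> [U []//|x V]; rewrite nbhsE => -[W [Wop Wx] WV].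
  have [a xa aW] := open_spec_phi_sub Wop Wx.
  exists (spec_phi a); last exact: subset_trans WV.
  by split=> //; apply/compact_opens_spec_phi; exists a.
Qed.

End Spectrum.

(** * The involution and the relation on the spectrum *)

Lemma spec_gK (d : Order.disp_t) (A : deMorganType d) :
  involutive (@spec_g d A).
Proof.
by move=> x; apply: prime_spectrum_ext => a /=; rewrite dmnegK notK.
Qed.

Lemma dm_star_spec_phi (d : Order.disp_t) (A : deMorganType d) (a : A) :
  dm_star (@spec_g d A) (spec_phi a) = spec_phi (dmneg a).
Proof. by apply/seteqP; split=> x; rewrite /dm_star /= notK. Qed.

(** A prime filter is [spec_R]-related to [y] exactly when it avoids this ideal. *)
Lemma lattice_ideal_nabla (d : Order.disp_t) (A : s4DeMorganType d)
    (y : prime_spectrum A) :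
  lattice_ideal [set a : A | ~ y (nabla a)].
Proof.
split.
- exists \bot%O => /=; rewrite nabla0 => y0.
  by have : spec_phi \bot%O y by []; rewrite spec_phi0.
- move=> a b ab yb ya; apply: yb; apply: spec_up ya.
  by rewrite -(join_r ab) nablaU leUl.
- by move=> a b ya yb; rewrite /= nablaU => /(prime_filter_join (pfilterP y))[].
Qed.

(** If [nabla a] is in [y], then [a] is outside the ideal attached to [y], so some prime filter
    containing [a] avoids that ideal and is the required predecessor of [y]. *)
Lemma nabla_spec_phi (d : Order.disp_t) (A : s4DeMorganType d) (a : A) :
  nabla_rel (@spec_R d A) (spec_phi a) = spec_phi (nabla a).
Proof.
apply/seteqP; split=> y; first by move=> [x xa]; exact.
move=> ya; have [|x xa xI] := prime_spectrum_avoid (a := a) (lattice_ideal_nabla y).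
  by move=> /(_ ya).
by exists x => // b xb; apply: contrapT => yb; exact: (xI b).
Qed.

Theorem lemma3p11 (d : Order.disp_t) (A : s4DeMorganType d) :
  s4_de_morgan_spectral_space (prime_spectrum A) (@spec_g d A) (@spec_R d A).
Proof.
split.
- exact: spectral_prime_spectrum.
- exact: spec_gK.
(* Membership of [a] in [spec_g x] is absence of [dmneg a] from [x], so testing on
   [spec_phi (dmneg a)] reverses the order. *)
- move=> x y xy U Uop /(open_spec_phi_sub Uop)[a ya aU]; apply: aU => /= xa.
  by apply: ya; apply: (xy (spec_phi (dmneg a))) => //; exact: open_spec_phi.
- by move=> x a; apply: spec_up; exact: le_nabla.
- move=> x y z xy yz a /xy/yz; apply: spec_up; exact: nabla_nabla_le.
- move=> U /compact_opens_spec_phi[a ->]; rewrite dm_star_spec_phi.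
  by apply/compact_opens_spec_phi; exists (dmneg a).
- move=> U /compact_opens_spec_phi[a ->]; rewrite nabla_spec_phi.
  by apply/compact_opens_spec_phi; exists (nabla a).
- move=> x y /existsNP[a /not_implyP[xa ya]]; exists (spec_phi a).
  by split=> //; [apply/compact_opens_spec_phi; exists a | rewrite nabla_spec_phi].
Qed.
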